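(* Let $P$ be an $r$-pattern, and let $v$ be a vertex of $P$ such that some maximal weighting of $P$ assigns $v$ positive weight. Suppose that the Frankl–Rödl construction $\mathrm{FR}_v(P)$ satisfies $$\lambda\left(\mathrm{FR}_v(P)\right)=\lambda(P)\quad\text{and}\quad r!\,\lambda(P)<1.$$ Then $r!\,\lambda(P)$ is not a jump for $r$-graphs.
   Context: For a set $S$, $S^{(r)}$ denotes the set of all $r$-element subsets of $S$. An $r$-graph is a pair $G=(V(G),E(G))$ with $V(G)$ finite and $E(G)\subseteq V(G)^{(r)}$. Its order is $|V(G)|$, and its density is $|E(G)|/|V(G)^{(r)}|$. A number $\alpha\in[0,1)$ is a jump for $r$-graphs if there is $\delta=\delta(\alpha)>0$ such that for each $\varepsilon>0$ and each integer $n\geq r$, any sufficiently large $r$-graph (i.e. of order at least some $N=N(\varepsilon,n)$) of density at least $\alpha+\varepsilon$ has a subgraph of order $n$ and density at least $\alpha+\delta$. An $r$-pattern $P=(V(P),E(P))$ is defined like an $r$-graph except that edges may be any multisets of size $r$ on the finite vertex set $V(P)$ (so $E(P)$ is a set of such multisets). For an edge $e$, $m_e(v)$ denotes the multiplicity of $v$ in $e$. Lagrangian: a weighting $w$ of $V(P)$ assigns to each vertex $v$ a real weight $w(v)\ge 0$ with $\sum_{v}w(v)=1$. Put $w(e)=\prod_{v\in V(P)}\frac{w(v)^{m_e(v)}}{m_e(v)!}$ for each edge $e$, $w(P)=\sum_{e\in E(P)}w(e)$, and $\lambda(P)=\max\{w(P): w \text{ a weighting of } V(P)\}$. A weighting attaining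 this maximum is called a maximal weighting of $P$. Blow-up: given positive integers $\mathbf{k}=(k_u)_{u\in V(P)}$, the blow-up $P(\mathbf{k})$ is the $r$-pattern with vertex set $\{(u,i):u\in V(P),1\le i\le k_u\}$ in which the multiset $(u_1,i_1)\dots(u_r,i_r)$ is an edge if and only if the multiset $u_1\dots u_r$ is an edge of $P$. Frankl–Rödl construction: for $v\in V(P)$, set $k_v=r$ and $k_u=1$ for all other vertices $u$. Let $P'$ be the $r$-pattern on the vertex set of $P(\mathbf{k})$ with edge set $E(P')=\{e\in E(P(\mathbf{k})): m_e((v,i))\le 1 \text{ for all } i\in\{2,\dots,r\}\}$. Then $\mathrm{FR}_v(P)$ is the $r$-pattern obtained from $P'$ by adding the single edge $\{(v,1),(v,2),\dots,(v,r)\}$. *)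

(* Defs.v *)
From HB Require Import structures.
From mathcomp Require Import all_boot all_order all_algebra.
From mathcomp Require Import all_classical all_reals all_analysis.

Set Implicit Arguments.
Unset Strict Implicit.
Unset Printing Implicit Defensive.

Import Order.TTheory GRing.Theory Num.Theory.
Import numFieldNormedType.Exports.

Local Open Scope ring_scope.

(** * r-graphs, density and jumps *)

Definition rsubsets (T : finType) (r : nat) (S : {set T}) : {set {set T}} :=
  [set A : {set T} | (A \subset S) && (#|A| == r)].

Record rgraph (r : nat) (T : finType) := RGraph {
  vertices : {set T};
  edges : {set {set T}};
  edges_rsubsets : edges \subset rsubsets r vertices }.

Definition rgraph_order (r : nat) (T : finType) (G : rgraph r T) : nat :=
  #|vertices G|.

Definition density (R : realType) (r : nat) (T : finType) (G : rgraph r T) : R :=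
  #|edges G|%:R / #|rsubsets r (vertices G)|%:R.

(* Not necessarily induced. *)
Definition subgraph (r : nat) (T : finType) (H G : rgraph r T) : bool :=
  (vertices H \subset vertices G) && (edges H \subset edges G).

(* The notion is used for [0 <= alpha < 1] only; the range is not repeated
   inside the predicate, so that a negated [jump] cannot hold merely because
   [alpha] is out of range. *)
Definition jump (R : realType) (r : nat) (alpha : R) : Prop :=
  exists2 delta : R, 0 < delta &
    forall (eps : R) (n : nat), 0 < eps -> (r <= n)%N ->
    exists N : nat, forall (T : finType) (G : rgraph r T),
      (N <= rgraph_order G)%N -> alpha + eps <= density R G ->
      exists H : rgraph r T,
        [/\ subgraph H G, rgraph_order H = n & alpha + delta <= density R H].

(** * r-patterns and their Lagrangians *)

(* A multiset of size r on V is given by its multiplicity function, whose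
   values are at most r; this makes the type of such multisets finite. *)
Record rmset (r : nat) (V : finType) := RMset {
  mult :> {ffun V -> 'I_r.+1};
  _ : (\sum_u mult u)%N == r }.

#[hnf] HB.instance Definition _ (r : nat) (V : finType) :=
  [isSub for @mult r V].
#[hnf] HB.instance Definition _ (r : nat) (V : finType) :=
  [Countable of rmset r V by <:].
#[hnf] HB.instance Definition _ (r : nat) (V : finType) :=
  [Finite of rmset r V by <:].

Definition pattern (r : nat) (V : finType) := {set rmset r V}.

Definition weighting (R : realType) (V : finType) (w : V -> R) : Prop :=
  (forall u, 0 <= w u) /\ \sum_u w u = 1.

Definition edge_weight (R : realType) (r : nat) (V : finType) (w : V -> R)
    (e : rmset r V) : R :=
  \prod_u (w u ^+ e u / (e u)`!%:R).

Definition pattern_weight (R : realType) (r : nat) (V : finType)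
    (P : pattern r V) (w : V -> R) : R :=
  \sum_(e in P) edge_weight w e.

(* The supremum is a maximum as soon as V is nonempty: see [lagrangian_max]. *)
Definition lagrangian (R : realType) (r : nat) (V : finType)
    (P : pattern r V) : R :=
  sup [set x | exists2 w : V -> R, weighting w & x = pattern_weight P w]%classic.

Definition maximal_weighting (R : realType) (r : nat) (V : finType)
    (P : pattern r V) (w : V -> R) : Prop :=
  weighting w /\ pattern_weight P w = lagrangian R P.

(** * Blow-ups and the Frankl–Rödl construction *)

(* The vertices of a blow-up are the pairs (u, i) with i : 'I_(k u), so that
   the copies of u are numbered from 0 and not from 1.  The multiset
   underlying e has multiplicity \sum_i e (u, i) at u. *)
Definition blowup (r : nat) (V : finType) (k : V -> nat) (P : pattern r V) :
    pattern r {u : V & 'I_(k u)} :=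
  [set e : rmset r {u : V & 'I_(k u)} | [exists f in P,
     [forall u, (\sum_(i < k u) e (Tagged (fun u => 'I_(k u)) i))%N == f u]]].

Definition FR_copies (r : nat) (V : finType) (v u : V) : nat :=
  if u == v then r else 1%N.

Definition FR (r : nat) (V : finType) (v : V) (P : pattern r V) :
    pattern r {u : V & 'I_(FR_copies r v u)} :=
  [set e in blowup (FR_copies r v) P |
     [forall x : {u : V & 'I_(FR_copies r v u)},
       (tag x == v) && (0 < tagged x)%N ==> (e x <= 1)%N]]
  :|: [set e : rmset r _ | [forall x, e x == (tag x == v) :> nat]].

(** * The Lagrangian is attained *)

Lemma continuous_big (R : realType) (T : topologicalType) (I : Type)
    (op : R -> R -> R) (x0 : R) (s : seq I) (A : pred I) (F : I -> T -> R) :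
  (forall f g : T -> R, continuous f -> continuous g ->
    continuous (fun x => op (f x) (g x))) ->
  (forall i, continuous (F i)) ->
  continuous (fun x => \big[op/x0]_(i <- s | A i) F i x).
Proof.
move=> opC FC; elim: s => [|i s IH].
  under [X in continuous X]eq_fun do rewrite big_nil.
  by move=> x; exact: cvg_cst.
under [X in continuous X]eq_fun do rewrite big_cons.
by case: (A i) => //; exact: opC.
Qed.

Lemma continuous_sum (R : realType) (T : topologicalType) (I : Type)
    (s : seq I) (A : pred I) (F : I -> T -> R) :
  (forall i, continuous (F i)) ->
  continuous (fun x => \sum_(i <- s | A i) F i x).
Proof.
by apply: continuous_big => f g fC gC x; apply: cvgD; [exact: fC|exact: gC].
Qed.

Lemma continuous_prod (R : realType) (T : topologicalType) (I : Type)
    (s : seq I) (A : pred I) (F : I -> T -> R) :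
  (forall i, continuous (F i)) ->
  continuous (fun x => \prod_(i <- s | A i) F i x).
Proof.
by apply: continuous_big => f g fC gC x; apply: cvgM; [exact: fC|exact: gC].
Qed.

(* The product topology on weight vectors. *)
Local Notation weights R V :=
  (prod_topology (fun _ : V => (R : topologicalType))).

Lemma continuous_coord (R : realType) (V : finType) (u : V) :
  continuous (fun w : weights R V => w u).
Proof. exact: (@proj_continuous V (fun=> R) u). Qed.

Lemma pattern_weight_continuous (R : realType) (r : nat) (V : finType)
    (P : pattern r V) : continuous (fun w : weights R V => pattern_weight P w).
Proof.
apply: continuous_sum => e; apply: continuous_prod => u w.
apply: (@cvgM _ _ (nbhs w) _ (fun w : weights R V => w u ^+ e u)
  (fun=> ((e u)`!%:R)^-1)); last exact: cvg_cst.
apply: (@cvg_comp _ _ _ (fun w : weights R V => w u)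
  (fun x : R => x ^+ e u) (nbhs w) (nbhs (w u))).
  exact: continuous_coord.
exact: exprn_continuous.
Qed.

Lemma weighting_compact (R : realType) (V : finType) :
  compact [set w : weights R V | weighting w]%classic.
Proof.
have KC := @tychonoff V (fun=> R) (fun=> `[0, 1]%classic)
  (fun=> @segment_compact R 0 1).
apply: (subclosed_compact _ KC).
- rewrite [X in closed X](_ : _ =
    \bigcap_u ((fun w : weights R V => w u) @^-1` [set x | 0 <= x]) `&`
    ((fun w : weights R V => \sum_u w u) @^-1` [set 1]))%classic; last first.
    apply/seteqP; split=> w /=; first by case=> w0 w1; split => // u _ /=.
    by case=> w0 w1; split => // u; exact: (w0 u I).
  apply: closedI.
    apply: closed_bigI => u _; apply: preimage_closed; last exact: closed_ge.
    by move=> w _; exact: continuous_coord.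
  apply: preimage_closed; last exact: closed_eq.
  by move=> w _; apply: continuous_sum => u; exact: continuous_coord.
- move=> w [w0 w1] u /=; rewrite in_itv /= w0 /= -w1 (bigD1 u) //=.
  by rewrite lerDl sumr_ge0.
Qed.

Lemma lagrangian_max (R : realType) (r : nat) (V : finType) (P : pattern r V) :
  (0 < #|V|)%N ->
  (exists w : V -> R, maximal_weighting P w) /\
  (forall w : V -> R, weighting w -> pattern_weight P w <= lagrangian R P).
Proof.
move=> /card_gt0P[v _].
set W := [set w : weights R V | weighting w]%classic.
have W0 : (W !=set0)%classic.
  exists (fun u => (u == v)%:R); split=> [u|]; first exact: ler0n.
  by rewrite (bigD1 v) //= eqxx big1 ?addr0 // => u /negbTE->.
have [c] := compact_EVT_max W0 (@weighting_compact R V)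
  (continuous_subspaceT (@pattern_weight_continuous R r V P)).
rewrite inE => Wc maxc.
have ubc w : weighting w -> pattern_weight P w <= pattern_weight P c.
  by move=> Ww; apply: maxc; rewrite inE.
have supc : lagrangian R P = pattern_weight P c.
  apply/eqP; rewrite eq_le; apply/andP; split.
    apply: ge_sup; first by exists (pattern_weight P c); exists c.
    by move=> _ [w Ww ->]; exact: ubc.
  apply: ub_le_sup; last by exists c.
  by exists (pattern_weight P c) => _ [w Ww ->]; exact: ubc.
by split=> [|w Ww]; [exists c; split | rewrite supc ubc].
Qed.

(* Main.v *)
(** If [alpha = r! lambda(P)] were a jump, then for some [n] every large enough
    graph of density at least [alpha + eps] would contain a graph on [n] vertices
    whose value at the uniform weighting exceeds [lambda(P)].  Take a blow-up of
    [P] with parts proportional to a maximal weighting, which has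
    [lambda(P) t^r - O(t^(r-1))] edges, and add to the part of [v] a random
    [r]-graph with at least [C t^(r-1)] edges in which any [s <= n + r] vertices
    span at most [s - r + 1] edges.  All blow-ups of the resulting graph have
    density at least [alpha + eps] for a fixed [eps > 0].  On the other hand, its
    value at a weighting with at most [n] nonzero weights is at most
    [lambda(FR_v(P))]: if [y_1 >= y_2 >= ...] are the weights in the part of [v],
    the added edges weigh at most [y_1 ... y_(r-1) (y_r + y_(r+1) + ...)], which
    is the weight of the special edge of [FR_v(P)] once all vertices of the part
    except the first [r - 1] are merged into [(v, 1)], while merging does not
    decrease the weight of the other edges. *)

Require Import Defs.
From mathcomp Require Import all_boot all_order all_algebra.
From mathcomp Require Import all_classical all_reals all_analysis.
From mathcomp Require Import zify ring lra fintype finset.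

Set Implicit Arguments.
Unset Strict Implicit.
Unset Printing Implicit Defensive.

Import Order.TTheory GRing.Theory Num.Theory.
Local Open Scope ring_scope.

(** * Elementary symmetric sums *)

Definition fiber (X Q : finType) (psi : X -> Q) (q : Q) : {set X} :=
  [set a | psi a == q].

Definition elem_sym (R : realFieldType) (X : finType) (x : X -> R) (S : {set X})
    (m : nat) : R :=
  \sum_(B : {set X} | (B \subset S) && (#|B| == m)) \prod_(b in B) x b.

Lemma elem_sym0 (R : realFieldType) (X : finType) (x : X -> R) (S : {set X}) :
  elem_sym x S 0 = 1.
Proof.
rewrite /elem_sym (big_pred1 set0) ?big_set0 // => B.
by rewrite cards_eq0 /=; case: eqVneq => [->|_]; rewrite ?sub0set ?andbF.
Qed.

Lemma elem_sym_ge0 (R : realFieldType) (X : finType) (x : X -> R)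
    (S : {set X}) m :
  (forall a, 0 <= x a) -> 0 <= elem_sym x S m.
Proof. by move=> x0; apply: sumr_ge0 => B _; exact: prodr_ge0. Qed.

(** Double counting of pairs [(B, b)] with [b \in B]: removing [b] leaves an [m]-set that avoids
    [b]. The bound comes from allowing all [m]-sets, including those that contain [b]. *)
Lemma elem_symS_le (R : realFieldType) (X : finType) (x : X -> R)
    (S : {set X}) m :
  (forall a, 0 <= x a) ->
  m.+1%:R * elem_sym x S m.+1 <= (\sum_(a in S) x a) * elem_sym x S m.
Proof.
move=> x0; rewrite /elem_sym mulr_sumr.
have -> : \sum_(B : {set X} | (B \subset S) && (#|B| == m.+1))
    m.+1%:R * \prod_(b in B) x b =
  \sum_(B : {set X} | (B \subset S) && (#|B| == m.+1)) \sum_(b in B)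
    x b * \prod_(c in B :\ b) x c.
  apply: eq_bigr => B /andP[_ /eqP cB].
  transitivity (\sum_(b in B) \prod_(c in B) x c).
    by rewrite sumr_const cB mulr_natl.
  by apply: eq_bigr => b bB; exact: big_setD1.
rewrite (exchange_big_dep (mem S)) /=; last first.
  by move=> B b /andP[/subsetP sB _] /sB.
rewrite mulr_suml; apply: ler_sum => b bS.
rewrite -mulr_sumr ler_wpM2l //.
rewrite (reindex_onto (fun B => b |: B) (fun B => B :\ b)) /=; last first.
  by move=> B /andP[_ bB]; rewrite setD1K.
rewrite [leRHS](bigID (fun B : {set X} => b \notin B)) /= -[leLHS]addr0.
apply: lerD; last by apply: sumr_ge0 => B _; exact: prodr_ge0.
rewrite le_eqVlt; apply/orP; left; apply/eqP; apply: eq_big => [B|B].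
  rewrite setU11 andbT subUset sub1set bS /=.
  have [bB|bB] := boolP (b \in B).
    rewrite andbF; apply/negP => /andP[_ /eqP/setP/(_ b)].
    by rewrite in_setD1 eqxx bB.
  by rewrite setU1K // eqxx !andbT cardsU1 bB add1n eqSS.
by move=> /andP[_ /eqP ->].
Qed.

Lemma elem_sym_le (R : realFieldType) (X : finType) (x : X -> R)
    (S : {set X}) m :
  (forall a, 0 <= x a) ->
  elem_sym x S m <= (\sum_(a in S) x a) ^+ m / m`!%:R.
Proof.
move=> x0; elim: m => [|m IH]; first by rewrite elem_sym0 expr0 fact0 divr1.
have s0 : 0 <= \sum_(a in S) x a by exact: sumr_ge0.
rewrite -(@ler_pM2l _ m.+1%:R) ?ltr0n //.
apply: (le_trans (elem_symS_le _ _ x0)).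
apply: (le_trans (ler_wpM2l s0 IH)).
rewrite factS natrM invfM (mulrCA m.+1%:R) (mulrA m.+1%:R).
by rewrite mulfV ?pnatr_eq0 // mul1r exprS mulrA.
Qed.

Lemma elem_sym_card (R : realFieldType) (X : finType) (S : {set X}) m :
  elem_sym (fun=> 1 : R) S m = 'C(#|S|, m)%:R.
Proof.
rewrite /elem_sym (eq_bigr (fun=> 1)) => [|B _]; last by rewrite big1.
rewrite sumr_const -cards_draws cardE /=; congr (_ *+ _).
by rewrite -cardE; apply: eq_card => B; rewrite !inE.
Qed.

Lemma elem_sym1 (R : realFieldType) (X : finType) (x : X -> R) (S : {set X}) :
  elem_sym x S 1 = \sum_(a in S) x a.
Proof.
rewrite /elem_sym (eq_bigl (mem [set [set a] | a in S])) => [|B]; last first.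
  apply/andP/imsetP => [[sB /cards1P[a Ba]]|[a aS ->]].
    by exists a => //; rewrite -sub1set -Ba.
  by rewrite sub1set cards1.
rewrite big_imset /= => [|a b _ _ /set1_inj //].
by under eq_bigr do rewrite big_set1.
Qed.

(** A set amounts to the family of its traces on the fibers, so expanding the product of sums lists
    every set with the prescribed trace sizes exactly once. *)
Lemma elem_sym_fibers (R : realFieldType) (X Q : finType) (x : X -> R)
    (psi : X -> Q) (e : Q -> nat) :
  \sum_(A : {set X} | [forall q, #|A :&: fiber psi q| == e q])
     \prod_(a in A) x a = \prod_q elem_sym x (fiber psi q) (e q).
Proof.
rewrite /elem_sym bigA_distr_big_dep /=.
rewrite (reindex_onto (fun A : {set X} => [ffun q => A :&: fiber psi q])
  (fun f : {ffun Q -> {set X}} => \bigcup_q f q)) /=; last first.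
  move=> f /familyP ff; apply/ffunP => q; rewrite ffunE; apply/setP => a.
  have fq p b : b \in f p -> psi b = p.
    have /andP[/subsetP sf _] := ff p.
    by move=> /sf; rewrite inE => /eqP.
  rewrite !inE; apply/andP/idP => [[/bigcupP[p _ ap] /eqP <-]|aq].
    by rewrite (fq _ _ ap).
  by split; [apply/bigcupP; exists q | apply/eqP; exact: fq].
apply: eq_big => [A|A _]; last first.
  rewrite (partition_big psi predT) //=; apply: eq_bigr => q _.
  by rewrite ffunE; apply: eq_bigl => a; rewrite !inE.
have -> : \bigcup_q [ffun q => A :&: fiber psi q] q == A.
  apply/eqP/setP => a; apply/bigcupP/idP => [[q _]|aA].
    by rewrite ffunE inE => /andP[].
  by exists (psi a); rewrite // ffunE !inE aA eqxx.
rewrite andbT; apply/forallP/familyP => fA q; have := fA q; rewrite ffunE.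
  by rewrite unfold_in subsetIr.
by rewrite unfold_in => /andP[].
Qed.

(** Distinct indices have distinct size profiles, so a set is counted for at most one [i]. *)
Lemma elem_sym_types (R : realFieldType) (X Q I : finType) (x : X -> R)
    (psi : X -> Q) (T : {set I}) (ev : I -> Q -> nat) :
  (forall i j, ev i =1 ev j -> i = j) ->
  \sum_(A : {set X} |
        [exists i in T, [forall q, #|A :&: fiber psi q| == ev i q]])
     \prod_(a in A) x a =
  \sum_(i in T) \prod_q elem_sym x (fiber psi q) (ev i q).
Proof.
move=> ev_inj; under [RHS]eq_bigr do rewrite -elem_sym_fibers.
rewrite (exchange_big_dep (fun A : {set X} =>
  [exists i in T, [forall q, #|A :&: fiber psi q| == ev i q]])) /=; last first.
  by move=> i A iT iA; apply/existsP; exists i; rewrite iT.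
apply: eq_bigr => A /existsP[i /andP[iT /forallP iA]].
rewrite (big_pred1 i) // => j /=; apply/andP/eqP => [[_ /forallP jA]|->].
  by apply: ev_inj => q; rewrite -(eqP (iA q)) -(eqP (jA q)).
by split=> //; apply/forallP.
Qed.

(** * Blow-ups *)

Lemma card_fibers (X Q : finType) (psi : X -> Q) (A : {set X}) :
  (\sum_q #|A :&: fiber psi q|)%N = #|A|.
Proof.
rewrite -sum1_card (partition_big psi predT) //=; apply: eq_bigr => q _.
by rewrite -sum1_card; apply: eq_bigl => a; rewrite !inE.
Qed.

Lemma rmset_inj (r : nat) (V : finType) (e f : rmset r V) :
  (fun u => e u : nat) =1 (fun u => f u : nat) -> e = f.
Proof. by move=> ef; apply/val_inj/ffunP => u; apply/ord_inj/ef. Qed.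

Lemma rmset_sum (r : nat) (V : finType) (e : rmset r V) :
  (\sum_u e u)%N = r.
Proof. exact: eqP (valP e). Qed.

Lemma rmset_of_set (r : nat) (X Q : finType) (psi : X -> Q) (A : {set X}) :
  #|A| = r -> exists e : rmset r Q, forall q, e q = #|A :&: fiber psi q| :> nat.
Proof.
move=> cA; pose m := [ffun q => inord #|A :&: fiber psi q| : 'I_r.+1].
have mE q : m q = #|A :&: fiber psi q| :> nat.
  by rewrite ffunE inordK // ltnS -cA subset_leq_card ?subsetIl.
have sm : (\sum_q m q)%N == r.
  by under eq_bigr do rewrite mE; rewrite card_fibers cA.
by exists (RMset sm).
Qed.

(** Only the sets among the edges of a blow-up are kept, since they must form an [r]-graph; the
    parts are the fibers of [pi], and some may be empty. *)
Definition blowup_edges (r : nat) (X V : finType) (pi : X -> V)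
    (P : pattern r V) : {set {set X}} :=
  [set A | [exists e in P, [forall u, #|A :&: fiber pi u| == e u]]].

Lemma blowup_edgesP (r : nat) (X V : finType) (pi : X -> V) (P : pattern r V)
    (A : {set X}) :
  reflect (exists2 e, e \in P & forall u, #|A :&: fiber pi u| = e u)
    (A \in blowup_edges pi P).
Proof.
rewrite inE; apply: (iffP existsP) => [[e /andP[eP /forallP eA]]|[e eP eA]].
  by exists e => // u; apply/eqP.
by exists e; rewrite eP; apply/forallP => u; apply/eqP.
Qed.

Lemma card_blowup_edge (r : nat) (X V : finType) (pi : X -> V)
    (P : pattern r V) (A : {set X}) : A \in blowup_edges pi P -> #|A| = r.
Proof.
move=> /blowup_edgesP[e _ eA]; rewrite -(card_fibers pi) -(rmset_sum e).
by apply: eq_bigr.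
Qed.

Lemma sum_blowup_edges (R : realType) (r : nat) (X V : finType) (x : X -> R)
    (pi : X -> V) (P : pattern r V) :
  \sum_(A in blowup_edges pi P) \prod_(a in A) x a =
  \sum_(e in P) \prod_u elem_sym x (fiber pi u) (e u).
Proof.
rewrite -(@elem_sym_types _ _ _ _ x pi P (fun e u => e u)) => [|e f ef].
  by apply: eq_bigl => A; rewrite inE.
exact: rmset_inj.
Qed.

(** Merging each fiber into one vertex does not decrease the weight, because an elementary symmetric
    sum is at most the matching power of the total over a factorial. *)
Lemma sum_blowup_edges_le (R : realType) (r : nat) (X V : finType)
    (x : X -> R) (pi : X -> V) (P : pattern r V) :
  (forall a, 0 <= x a) ->
  \sum_(A in blowup_edges pi P) \prod_(a in A) x a <=
  pattern_weight P (fun u => \sum_(a in fiber pi u) x a).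
Proof.
move=> x0; rewrite sum_blowup_edges; apply: ler_sum => e _.
by apply: ler_prod => u _; rewrite elem_sym_ge0 //= elem_sym_le.
Qed.

(** This is the blow-up of the hypergraph [E] along [pi]: an edge takes one point above each vertex
    of some [A] in [E], and no other point. *)
Definition transversals (X Y : finType) (pi : Y -> X) (E : {set {set X}}) :
    {set {set Y}} :=
  [set h | [exists A in E, [forall a, #|h :&: fiber pi a| == (a \in A)]]].

Lemma transversals_rsubsets (r : nat) (X Y : finType) (pi : Y -> X)
    (E : {set {set X}}) : (forall A, A \in E -> #|A| = r) ->
  transversals pi E \subset rsubsets r [set: Y].
Proof.
move=> Er; apply/subsetP => h; rewrite inE => /existsP[A /andP[AE /forallP hA]].
rewrite inE subsetT /= -(Er A AE) -(card_fibers pi h).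
rewrite -[#|A|]sum1_card [in X in _ == X]big_mkcond.
by apply/eqP; apply: eq_bigr => a _; rewrite (eqP (hA a)); case: ifP.
Qed.

Lemma sum_transversals (R : realFieldType) (X Y : finType) (x : Y -> R)
    (pi : Y -> X) (E : {set {set X}}) :
  \sum_(h in transversals pi E) \prod_(y in h) x y =
  \sum_(A in E) \prod_(a in A) \sum_(y in fiber pi a) x y.
Proof.
transitivity (\sum_(A in E) \prod_a elem_sym x (fiber pi a) (a \in A)).
  rewrite -(@elem_sym_types _ _ _ _ x pi E (fun A a => (a \in A))).
    by apply: eq_bigl => h; rewrite inE.
  by move=> A B AB; apply/setP => a; have := AB a; do 2 case: (_ \in _).
apply: eq_bigr => A _; rewrite [RHS]big_mkcond; apply: eq_bigr => a _.
by case: ifP => aA; rewrite /= ?elem_sym1 ?elem_sym0.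
Qed.

(** * Edge counts of blow-ups *)

Lemma prod_sub_le (R : realFieldType) (I : Type) (s : seq I) (x a d : I -> R) :
  (forall i, 0 <= x i <= 1) -> (forall i, 0 <= a i <= 1) ->
  (forall i, x i - a i <= d i) -> (forall i, 0 <= d i) ->
  \prod_(i <- s) x i - \prod_(i <- s) a i <= \sum_(i <- s) d i.
Proof.
move=> x01 a01 xad d0; elim: s => [|i s IH]; first by rewrite !big_nil subrr.
rewrite !big_cons.
have y0 : 0 <= \prod_(j <- s) a j by apply: prodr_ge0 => j _; case/andP: (a01 j).
have y1 : \prod_(j <- s) a j <= 1 by apply: prodr_ile1 => j _; exact: a01.
have := xad i; have := d0 i; case/andP: (x01 i) => ? ?; case/andP: (a01 i) => ? ?.
(* Telescoping: with tail products [X] and [A], the difference is [x i * (X - A) + (x i - a i) * A],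
   and both terms are bounded separately. *)
have : x i * (\prod_(j <- s) x j - \prod_(j <- s) a j) <=
       \sum_(j <- s) d j.
  case: (lerP 0 (\prod_(j <- s) x j - \prod_(j <- s) a j)) => ? /=.
    by apply: le_trans IH; rewrite ler_piMl.
  apply: (@le_trans _ _ 0); last by apply: sumr_ge0 => j _.
  by rewrite mulr_ge0_le0 // ltW.
have : (x i - a i) * \prod_(j <- s) a j <= d i.
  apply: (@le_trans _ _ (d i * \prod_(j <- s) a j)); first by rewrite ler_wpM2r.
  by rewrite ler_piMr.
lra.
Qed.

Lemma bin_sub_le (R : realFieldType) (r k m : nat) (x t : R) :
  0 < t -> 0 <= x <= 1 -> x * t - 1 <= k%:R <= x * t -> (m <= r)%N ->
  'C(k, m)%:R / t ^+ m <= 1 /\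
  x ^+ m / m`!%:R - 'C(k, m)%:R / t ^+ m <= m%:R * (r.+1%:R / t).
Proof.
move=> t0 x01 /andP[kge kle] mr.
(* The quotient is the product of these factors over [m!]. Each is at least [x - (i + 1) / t], and
   [i < m <= r] gives the error [r.+1 / t]; truncated subtraction keeps the factors nonnegative. *)
pose a (i : 'I_m) : R := (k - i)%:R / t.
have a01 i : 0 <= a i <= 1.
  rewrite /a divr_ge0 ?ler0n 1?[0 <= t]ltW //= ler_pdivrMr // mul1r.
  apply: (@le_trans _ _ k%:R); first by rewrite ler_nat leq_subr.
  by apply: (le_trans kle); case/andP: x01 => ? ?; rewrite ler_piMl // ltW.
have f0 : 0 < m`!%:R :> R by rewrite ltr0n fact_gt0.
have fV1 : m`!%:R^-1 <= 1 :> R by rewrite invf_le1 // ler1n fact_gt0.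
have aE : 'C(k, m)%:R / t ^+ m = (\prod_i a i) / m`!%:R.
  rewrite /a prodf_div prodr_const card_ord -natr_prod -ffact_prod -bin_ffact.
  by rewrite natrM mulrAC mulfK // gt_eqF.
split.
  rewrite aE; apply: mulr_ile1; rewrite ?invr_ge0 ?ler0n //.
    by apply: prodr_ge0 => i _; case/andP: (a01 i).
  by apply: prodr_ile1 => i _; exact: a01.
rewrite aE -mulrBl.
have D0 : 0 <= m%:R * (r.+1%:R / t) :> R.
  by rewrite mulr_ge0 ?ler0n // divr_ge0 ?ler0n // ltW.
apply: (@le_trans _ _ (m%:R * (r.+1%:R / t) / m`!%:R)); last first.
  by rewrite ler_piMr.
rewrite ler_wpM2r ?invr_ge0 ?ler0n //.
have := @prod_sub_le R 'I_m (index_enum _) (fun=> x) a (fun=> r.+1%:R / t).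
rewrite prodr_const sumr_const card_ord (mulr_natl _ m); apply=> // i; last first.
  by rewrite divr_ge0 ?ler0n // ltW.
rewrite /a ler_pdivlMr // mulrBl mulfVK ?gt_eqF //.
have : k%:R <= (k - i)%:R + i%:R :> R by rewrite -natrD ler_nat; lia.
have : i%:R <= r%:R :> R by rewrite ler_nat; have := ltn_ord i; lia.
rewrite -natr1; lra.
Qed.

(** With all weights 1 the edges of a given type number a product of binomials, each close to its
    value in [edge_weight]. The errors are proportional to the multiplicities, which sum to [r]. *)
Lemma blowup_edges_ge (R : realType) (r : nat) (X V : finType) (pi : X -> V)
    (P : pattern r V) (w : V -> R) (t : R) :
  0 < t -> (forall u, 0 <= w u <= 1) ->
  (forall u, w u * t - 1 <= #|fiber pi u|%:R <= w u * t) ->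
  t ^+ r * (pattern_weight P w - #|P|%:R * (r%:R * (r.+1%:R / t))) <=
  #|blowup_edges pi P|%:R.
Proof.
move=> t0 w01 fw.
have -> : #|blowup_edges pi P|%:R =
    \sum_(e in P) \prod_u 'C(#|fiber pi u|, e u)%:R :> R.
  transitivity (\sum_(A in blowup_edges pi P) \prod_(a in A) (1 : R)).
    by rewrite -sum1_card natr_sum; apply: eq_bigr => A _; rewrite big1.
  rewrite sum_blowup_edges; apply: eq_bigr => e _; apply: eq_bigr => u _.
  by rewrite elem_sym_card.
rewrite (mulr_natl _ #|P|) -sumr_const -sumrB mulr_sumr; apply: ler_sum => e _.
rewrite mulrC -ler_pdivlMr ?exprn_gt0 // -[in X in _ / t ^+ X](rmset_sum e).
rewrite -prodrXr -prodf_div.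
have B u := @bin_sub_le R r #|fiber pi u| (e u) (w u) t t0 (w01 u) (fw u)
  (ltn_ord (e u)).
have := @prod_sub_le R V (index_enum _) (fun u => w u ^+ e u / (e u)`!%:R)
  (fun u => 'C(#|fiber pi u|, e u)%:R / t ^+ e u)
  (fun u => (e u)%:R * (r.+1%:R / t)).
rewrite -mulr_suml -natr_sum rmset_sum lerBlDl -lerBlDr; apply=> u.
- case/andP: (w01 u) => w0 w1.
  rewrite divr_ge0 ?exprn_ge0 ?ler0n //= ler_pdivrMr ?ltr0n ?fact_gt0 // mul1r.
  by apply: (@le_trans _ _ 1); rewrite ?exprn_ile1 // ler1n fact_gt0.
- by case: (B u) => -> _; rewrite divr_ge0 ?ler0n // exprn_ge0 // ltW.
- by case: (B u).
- by rewrite mulr_ge0 ?ler0n // divr_ge0 ?ler0n // ltW.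
Qed.

(** * Locally sparse families *)

(** After cancelling the common part, every weight on [B :\: D] is at most the smallest weight on
    [D :\: B], and these two sets have the same size. *)
Lemma prod_top_le (R : realFieldType) (X : finType) (x : X -> R) (D B : {set X}) :
  (forall a, 0 <= x a) -> #|B| = #|D| ->
  (forall d b, d \in D -> b \in B -> b \notin D -> x b <= x d) ->
  \prod_(b in B) x b <= \prod_(d in D) x d.
Proof.
move=> x0 cBD top.
rewrite (big_setID D) [leRHS](big_setID B) /= setIC.
apply: ler_wpM2l; first exact: prodr_ge0.
have cD : #|B :\: D| = #|D :\: B|.
  by have := cardsID D B; have := cardsID B D; rewrite setIC; lia.
have [D0|[d0 d0D]] := set_0Vmem (D :\: B).
  have /eqP := cD; rewrite D0 cards0 cards_eq0 => /eqP ->.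
  by rewrite !big_set0.
have [c cD' cmin] := arg_minP x d0D; have /setDP[cD1 cB] := cD'.
apply: (@le_trans _ _ (\prod_(b in B :\: D) x c)).
  apply: ler_prod => b /setDP[bB bD]; rewrite x0 /=; exact: top.
rewrite prodr_const cD -prodr_const.
by apply: ler_prod => d dD; rewrite x0 /=; exact: cmin.
Qed.

Lemma exists_top (R : realFieldType) (X : finType) (x : X -> R) (U : {set X}) m :
  (m <= #|U|)%N -> exists D : {set X}, [/\ D \subset U, #|D| = m &
    forall d b, d \in D -> b \in U -> b \notin D -> x b <= x d].
Proof.
elim: m => [_|m IH mU].
  by exists set0; rewrite sub0set cards0; split=> // d b; rewrite inE.
have [D [DU cD top]] := IH (ltnW mU).
have [|[a aUD]] := set_0Vmem (U :\: D).
  move=> UD0; exfalso; move: mU.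
  by rewrite -(cardsID D U) UD0 cards0 (setIidPr DU) cD addn0 ltnn.
have [c cUD cmax] := arg_maxP x aUD; have /setDP[cU cD'] := cUD.
exists (c |: D); split; first by rewrite subUset sub1set cU.
  by rewrite cardsU1 cD' cD.
move=> d b /setU1P[->|dD] bU; rewrite in_setU1 negb_or => /andP[_ bD].
  by apply: cmax; apply/setDP.
exact: top.
Qed.

(* If the vertices of [S :\: D] are added in decreasing order of weight, each edge
   weighs at most the product over [D] times [x a], where [a] is its last vertex,
   and by sparsity the edges can be charged to distinct vertices.  The term with
   [y] accounts for the vertices not charged yet. *)
Lemma sparse_weight_slack (R : realFieldType) (X : finType) (x : X -> R)
    (D S : {set X}) (H : {set {set X}}) (y : R) :
  (forall a, 0 <= x a) -> D \subset S ->
  (forall d b, d \in D -> b \in S -> b \notin D -> x b <= x d) ->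
  (forall h, h \in H -> #|h| = #|D|.+1) ->
  (forall S' : {set X}, D \subset S' -> S' \subset S ->
     (#|[set h in H | h \subset S']| <= #|S' :\: D|)%N) ->
  0 <= y -> (forall b, b \in S :\: D -> y <= x b) ->
  \sum_(h in H | h \subset S) \prod_(a in h) x a +
    (#|S :\: D|%:R - #|[set h in H | h \subset S]|%:R) *
    (\prod_(d in D) x d * y) <=
  \prod_(d in D) x d * \sum_(b in S :\: D) x b.
Proof.
move=> x0 DS top cH sparse; set T := \prod_(d in D) x d.
have T0 : 0 <= T by exact: prodr_ge0.
move: {2}#|S :\: D| (erefl #|S :\: D|) => m.
elim: m S DS top sparse y => [|m IH] S DS top sparse y mS y0 yS.
  have SD : S = D.
    by apply/eqP; rewrite eqEsubset DS -setD_eq0 -cards_eq0 mS eqxx.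
  have := sparse S DS (subxx S); rewrite mS leqn0 cards_eq0 => /eqP HS0.
  rewrite HS0 cards0 subrr mul0r addr0 big_pred0 => [|h].
    by rewrite mulr_ge0 // sumr_ge0.
  by have /setP/(_ h) := HS0; rewrite !inE.
have [|[a0 a0S]] := set_0Vmem (S :\: D).
  by move=> S0; move: mS; rewrite S0 cards0.
(* The lightest vertex [a] outside [D] is removed, and its weight becomes the threshold in the
   induction hypothesis. *)
have [a] := arg_minP x a0S; rewrite -/(a \in S :\: D) => aSD amin.
have /setDP[aS aD] := aSD.
pose S' := S :\ a.
have S'D : S' :\: D = (S :\: D) :\ a.
  by apply/setP => b; rewrite !inE; case: (b == a); rewrite ?andbF.
have cS'D : #|S' :\: D| = m.
  by apply/eq_add_S; rewrite -mS (cardsD1 a (S :\: D)) aSD S'D.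
have S'S : S' \subset S by exact: subD1set.
have DS' : D \subset S' by rewrite subsetD1 DS aD.
have := IH S' DS'.
have top' d b : d \in D -> b \in S' -> b \notin D -> x b <= x d.
  by move=> dD /(subsetP S'S) bS; exact: top.
move=> /(_ top') /(_ (fun S'' h1 h2 => sparse S'' h1 (subset_trans h2 S'S))).
move=> /(_ (x a)) /(_ cS'D) /(_ (x0 a)).
have amin' b : b \in S' :\: D -> x a <= x b.
  by rewrite S'D => /setD1P[_ bSD]; exact: amin.
move=> /(_ amin').
rewrite (big_setD1 a aSD) /= -S'D cS'D mS => IH'.
pose E := [set h in H | h \subset S]; pose E' := [set h in H | h \subset S'].
have E'E : E' \subset E.
  by apply/subsetP => h; rewrite !inE => /andP[-> /= hS]; exact: subset_trans S'S.
(* Edges lost by removing [a] contain [a], and their other vertices weigh together at most the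
   product over [D]. *)
have new : \sum_(h in E :\: E') \prod_(b in h) x b <=
    (#|E|%:R - #|E'|%:R) * (T * x a).
  have -> : #|E|%:R - #|E'|%:R = #|E :\: E'|%:R :> R.
    by have := cardsID E' E; rewrite (setIidPr E'E) => <-; rewrite natrD; ring.
  rewrite mulr_natl -sumr_const; apply: ler_sum => h.
  rewrite !inE => /andP[hE' /andP[hH hS]]; move: hE'; rewrite hH subsetD1 hS /=.
  rewrite negbK => ah; rewrite (big_setD1 a ah) /= mulrC ler_wpM2r //.
  apply: prod_top_le => //.
    by apply/eq_add_S; rewrite -(cH _ hH) (cardsD1 a h) ah.
  by move=> d b dD /setD1P[_ /(subsetP hS)]; exact: top.
have EE : \sum_(h in H | h \subset S) \prod_(a in h) x a =
    \sum_(h in H | h \subset S') \prod_(a in h) x a +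
    \sum_(h in E :\: E') \prod_(b in h) x b.
  rewrite (eq_bigl (mem E)) => [|h]; last by rewrite !inE.
  rewrite [LHS](big_setID E') /= (setIidPr E'E); congr (_ + _).
  by apply: eq_bigl => h; rewrite !inE.
(* By sparsity the number of uncharged vertices is nonnegative, so the threshold may be lowered from
   [x a] to [y]. *)
have cE : #|E|%:R <= m.+1%:R :> R by rewrite ler_nat -mS; exact: sparse.
have : (m.+1%:R - #|E|%:R) * (T * y) <= (m.+1%:R - #|E|%:R) * (T * x a).
  by rewrite ler_wpM2l ?subr_ge0 // ler_wpM2l // yS.
rewrite EE -/E; move: IH' new; rewrite -/E' -(natr1 m) mulrDr.
move: (\sum_(h in H | _) _) (\sum_(h in E :\: E') _) (T * _) (T * y) (T * x a).
by move: (#|E|%:R) (#|E'|%:R) (m%:R) => e e' m' s' n t ty ta; lra.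
Qed.

Lemma sparse_weight (R : realFieldType) (X : finType) (x : X -> R)
    (D S : {set X}) (H : {set {set X}}) :
  (forall a, 0 <= x a) -> D \subset S ->
  (forall d b, d \in D -> b \in S -> b \notin D -> x b <= x d) ->
  (forall h, h \in H -> #|h| = #|D|.+1) ->
  (forall S' : {set X}, D \subset S' -> S' \subset S ->
     (#|[set h in H | h \subset S']| <= #|S' :\: D|)%N) ->
  \sum_(h in H | h \subset S) \prod_(a in h) x a <=
  \prod_(d in D) x d * \sum_(b in S :\: D) x b.
Proof.
move=> x0 DS top cH sparse.
have := sparse_weight_slack x0 DS top cH sparse (lexx 0).
by rewrite !mulr0 addr0; apply=> b _.
Qed.

(** * Random families of [r]-sets *)

(** Counting form of independence: if a set is selected when a uniform [phi] sends it to [ord0], all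
    members of [F] are selected with probability [1 / q.+1 ^ #|F|]. *)
Lemma card_vanishing (T : finType) (q : nat) (F : {set T}) :
  (q.+1 ^ #|F| * #|[set phi : {ffun T -> 'I_q.+1} |
                      [forall A in F, phi A == ord0]]| = q.+1 ^ #|T|)%N.
Proof.
have -> : #|[set phi : {ffun T -> 'I_q.+1} | [forall A in F, phi A == ord0]]| =
    (\prod_(A : T) (if A \in F then 1 else q.+1))%N.
  rewrite -sum1_card big_mkcond /=.
  transitivity (\sum_(phi : {ffun T -> 'I_q.+1})
      \prod_(A : T) ((A \in F) ==> (phi A == ord0) : nat))%N.
    apply: eq_bigr => phi _; rewrite inE; case: ifP => [/forallP F0|].
      by rewrite big1 // => A _; rewrite F0.
    move=> /negbT; rewrite negb_forall => /existsP[A /negbTE FA].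
    by rewrite (bigD1 A) //= FA mul0n.
  rewrite -(bigA_distr_bigA (fun A (c : 'I_q.+1) =>
    (A \in F) ==> (c == ord0) : nat)).
  apply: eq_bigr => A _; case: (A \in F) => /=; last first.
    by rewrite sum1_card card_ord.
  by rewrite (bigD1 ord0) //= big1 // => c /negbTE ->.
rewrite -prod_nat_const [X in (X * _)%N]big_mkcond -big_split /=.
rewrite (eq_bigr (fun=> q.+1)) ?prod_nat_const ?cardT // => A _.
by case: ifP; rewrite ?muln1 ?mul1n.
Qed.

(* [#|F| = #|S| - (r - 1) + 1] without subtraction: one member more than a sparse
   family may have inside [S]. *)
Definition dense_families (r k : nat) (X : finType) (U : {set X}) :
    {set {set {set X}}} :=
  [set F : {set {set X}} | [exists S : {set X}, [&& S \subset U, (#|S| <= k)%N,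
     F \subset powerset S & (#|F| + r == #|S| + 2)%N]]].

(** A set [S] carries at most [2 ^ 2 ^ #|S|] families, each contributing [q] to the power
    [r - 2 - #|S|]. There are at most [(L q) ^ i] sets [S] of size [i], so the powers of [q] that
    depend on [i] cancel. *)
Lemma sum_dense_families (r k L q : nat) (X : finType) (U : {set X}) :
  (0 < L)%N -> (0 < q)%N -> #|U| = (L * q)%N ->
  \sum_(F in dense_families r k U) (q%:R ^+ #|F|)^-1 <=
  (k.+1 * 2 ^ 2 ^ k * L ^ k)%:R * (q%:R ^+ r / q%:R ^+ 2) :> rat.
Proof.
move=> L0 q0 cU; set Q : rat := q%:R.
have Q0 : 0 < Q by rewrite ltr0n.
pose small (S : {set X}) := (S \subset U) && (#|S| <= k)%N.
pose spans (F : {set {set X}}) (S : {set X}) :=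
  (F \subset powerset S) && (#|F| + r == #|S| + 2)%N.
have B0 : 0 <= Q ^+ r / Q ^+ 2 by rewrite divr_ge0 ?exprn_ge0 // ltW.
have V0 i : 0 <= Q^-1 ^+ i by rewrite exprn_ge0 // invr_ge0 ltW.
have P0 i : 0 <= (Q ^+ i)^-1 by rewrite invr_ge0 exprn_ge0 // ltW.
apply: (@le_trans _ _ (\sum_(S | small S) \sum_(F | spans F S) (Q ^+ #|F|)^-1)).
  rewrite (exchange_big_dep predT) //= [leLHS]big_mkcond.
  apply: ler_sum => F _; case: ifP => [|_]; last exact: sumr_ge0.
  rewrite inE => /existsP[S /and4P[SU Sk FS cF]].
  rewrite (bigD1 S) /=; last by rewrite /small /spans SU Sk FS cF.
  by rewrite lerDl sumr_ge0.
have spansE S : \sum_(F | spans F S) (Q ^+ #|F|)^-1 <=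
    (2 ^ 2 ^ #|S|)%:R * (Q ^+ r / Q ^+ 2) * Q^-1 ^+ #|S|.
  apply: (@le_trans _ _ (\sum_(F | spans F S) (Q ^+ r / Q ^+ 2 * Q^-1 ^+ #|S|))).
    apply: ler_sum => F /andP[_ /eqP cF]; rewrite le_eqVlt; apply/orP; left.
    have QE : Q ^+ #|F| * Q ^+ r = Q ^+ #|S| * Q ^+ 2 by rewrite -!exprD cF.
    have n0 i : Q ^+ i != 0 by rewrite expf_neq0 // gt_eqF.
    apply/eqP/(mulfI (n0 #|F|)); rewrite mulfV // exprVn !mulrA QE.
    by rewrite mulfK // mulfV.
  rewrite sumr_const -[leRHS]mulrA -[leLHS]mulr_natl ler_wpM2r //.
    by rewrite mulr_ge0.
  rewrite -!card_powerset ler_nat; apply: subset_leq_card; apply/subsetP => F.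
  by rewrite !inE => /andP[].
apply: (le_trans (ler_sum _ (fun S _ => spansE S))).
apply: (@le_trans _ _ (\sum_(S | small S)
    (2 ^ 2 ^ k)%:R * (Q ^+ r / Q ^+ 2) * Q^-1 ^+ #|S|)).
  apply: ler_sum => S /andP[_ Sk].
  by rewrite ler_wpM2r ?V0 // ler_wpM2r ?B0 // ler_nat !leq_exp2l.
rewrite -mulr_sumr.
have -> : \sum_(S | small S) Q^-1 ^+ #|S| =
    \sum_(i < k.+1) elem_sym (fun=> Q^-1) U i.
  rewrite (partition_big (fun S : {set X} => inord #|S| : 'I_k.+1) predT) //=.
  apply: eq_bigr => i _; rewrite /elem_sym; apply: eq_big => [S|S _]; last first.
    by rewrite prodr_const.
  rewrite /small -andbA; congr (_ && _); apply/andP/eqP => [[Sk /eqP <-]|cS].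
    by rewrite inordK.
  have := ltn_ord i; rewrite -cS ltnS => Sk; split=> //.
  by apply/eqP/ord_inj; rewrite inordK.
have L1 : 1 <= L%:R :> rat by rewrite ler1n.
have : \sum_(i < k.+1) elem_sym (fun=> Q^-1) U i <= \sum_(i < k.+1) L%:R ^+ k.
  apply: ler_sum => i _.
  apply: (le_trans (elem_sym_le _ _ _)) => [a|]; first by rewrite invr_ge0 ltW.
  rewrite sumr_const cU -(mulr_natr Q^-1) natrM (mulrC Q^-1) mulfK ?gt_eqF //.
  apply: (@le_trans _ _ (L%:R ^+ i)); last by rewrite ler_weXn2l // -ltnS.
  rewrite ler_pdivrMr ?ltr0n ?fact_gt0 // ler_peMr ?exprn_ge0 ?ler0n //.
  by rewrite ler1n fact_gt0.
rewrite sumr_const card_ord => sumL.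
apply: (le_trans (ler_wpM2l _ sumL)).
  by rewrite mulr_ge0 ?ler0n.
rewrite -[in leLHS]mulr_natl !natrM -(natrX _ L) le_eqVlt; apply/orP; left.
by apply/eqP; ring.
Qed.

Lemma bin_ge (s r : nat) : (r.*2 <= s)%N -> (s ^ r <= 2 ^ r * r`! * 'C(s, r))%N.
Proof.
move=> rs; rewrite -mulnA (mulnC r`!) bin_ffact ffact_prod.
rewrite -[X in (s ^ X <= _)%N]card_ord -[X in (_ <= 2 ^ X * _)%N]card_ord.
rewrite -!prod_nat_const -big_split /=; apply: leq_prod => i _.
have := ltn_ord i; lia.
Qed.

(** First-moment argument: each [r]-set is selected with probability [1/q], and some outcome reaches
    the expectation of the number of selected sets minus the number of dense families selected in
    full. *)
Lemma exists_random_family (r k q : nat) (X : finType) (U : {set X}) :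
  (0 < q)%N ->
  exists Z : {set {set X}}, Z \subset rsubsets r U /\
    #|rsubsets r U|%:R / q%:R -
      \sum_(F in dense_families r k U) (q%:R ^+ #|F|)^-1 <=
    #|Z|%:R - #|[set F in dense_families r k U | F \subset Z]|%:R :> rat.
Proof.
case: q => // q _.
pose Phi := {ffun {set X} -> 'I_q.+1}.
pose Z (phi : Phi) := [set A in rsubsets r U | phi A == ord0].
pose Y phi := [set F in dense_families r k U | F \subset Z phi].
set c := #|rsubsets r U|%:R / q.+1%:R -
  \sum_(F in dense_families r k U) (q.+1%:R ^+ #|F|)^-1 : rat.
suff [phi cphi] : exists phi : Phi, c <= #|Z phi|%:R - #|Y phi|%:R.
  by exists (Z phi); split=> //; apply/subsetP => A; rewrite inE => /andP[].
apply: contrapT => /forallNP noZ.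
have N0 : 0 < #|Phi|%:R :> rat.
  by rewrite card_ffun card_ord ltr0n expn_gt0.
have vanish (F : {set {set X}}) :
    \sum_(phi : Phi | [forall A in F, phi A == ord0]) 1 =
    #|Phi|%:R * (q.+1%:R ^+ #|F|)^-1 :> rat.
  rewrite sumr_const card_ffun card_ord -(@card_vanishing _ _ F) natrM natrX.
  rewrite mulrAC mulfV ?mul1r ?expf_neq0 ?pnatr_eq0 //.
  by congr (_%:R); apply: eq_card => phi; rewrite inE.
have sumZ : \sum_(phi : Phi) #|Z phi|%:R =
    #|Phi|%:R * (#|rsubsets r U|%:R / q.+1%:R) :> rat.
  transitivity (\sum_(A in rsubsets r U) \sum_(phi : Phi | phi A == ord0)
      (1 : rat)).
    rewrite (exchange_big_dep predT) //=; apply: eq_bigr => phi _.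
    by rewrite -sum1_card natr_sum; apply: eq_bigl => A; rewrite inE.
  rewrite (eq_bigr (fun=> #|Phi|%:R / q.+1%:R)) => [|A _]; last first.
    have := vanish [set A]; rewrite cards1 expr1 => <-; apply: eq_bigl => phi.
    apply/idP/forallP => [pA B|/(_ A)]; last by rewrite set11.
    by apply/implyP => /set1P ->.
  by rewrite sumr_const -[LHS]mulr_natl mulrCA.
have sumY : \sum_(phi : Phi) #|Y phi|%:R <= #|Phi|%:R *
    \sum_(F in dense_families r k U) (q.+1%:R ^+ #|F|)^-1 :> rat.
  rewrite mulr_sumr.
  under [leRHS]eq_bigr do rewrite -vanish.
  rewrite [leRHS](exchange_big_dep predT) //=; apply: ler_sum => phi _.
  rewrite sumr_const ler_nat; apply: subset_leq_card; apply/subsetP => F.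
  rewrite in_set => /andP[FD /subsetP FZ].
  rewrite unfold_in FD; apply/forallP => A.
  by apply/implyP => /FZ; rewrite inE => /andP[].
have : \sum_(phi : Phi) (#|Z phi|%:R - #|Y phi|%:R) < \sum_(phi : Phi) c.
  apply: ltr_sum => [|phi _]; last by rewrite ltNge; apply/negP/noZ.
  have /card_gt0P[phi0 _] : (0 < #|Phi|)%N by rewrite -(ltr0n rat).
  by apply/hasP; exists phi0 => //; exact: mem_index_enum.
rewrite sumrB sumZ sumr_const -(mulr_natl c) /c mulrBr ltNge; move/negP; apply.
by rewrite lerB.
Qed.

(* With [s = L q] vertices and edges chosen with probability [1/q], the expected
   number of edges is of order [L s^(r-1)], while that of dense families is
   [O(q^(r-2))]: one edge of each of them can be removed. *)
Lemma exists_sparse_family (r k C : nat) : (0 < r)%N ->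
  exists s : nat, [/\ (0 < s)%N, (r <= s)%N &
    forall (X : finType) (U : {set X}), #|U| = s ->
    exists H : {set {set X}}, [/\ H \subset rsubsets r U,
      forall S : {set X}, S \subset U -> (#|S| <= k)%N ->
        (#|[set h in H | h \subset S]| <= #|S| - r.-1)%N &
      (C * s ^ r.-1 <= #|H|)%N]].
Proof.
case: r => // r _; rewrite /=.
(* The factor [A] is the loss in [bin_ge], so [L] yields at least [2 (C + 1) s ^ r] expected edges.
   Taking [q >= K] bounds the expected number of dense families by [s ^ r], and [q >= 2 (r + 1)]
   lets [bin_ge] apply. *)
pose A := (2 ^ r.+1 * r.+1`!)%N; pose L := (A * C.+1.*2)%N.
have A0 : (0 < A)%N by rewrite muln_gt0 expn_gt0 fact_gt0.
have L0 : (0 < L)%N by rewrite muln_gt0 A0.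
pose K := (k.+1 * 2 ^ 2 ^ k * L ^ k)%N.
pose q := (K + r.+1.*2)%N.
have q0 : (0 < q)%N by rewrite /q; lia.
have qs : (q <= L * q)%N by rewrite leq_pmull.
exists (L * q)%N; split; [by rewrite muln_gt0 L0 | by rewrite /q in qs *; lia |].
set s := (L * q)%N => X U cU.
have [Z [ZU cZ]] := exists_random_family r.+1 k U q0.
(* The set to delete from each dense family. The default [set0] is returned only for the empty
   family, and deleting it is harmless since members of [Z] are nonempty. *)
pose pickF (F : {set {set X}}) := odflt set0 [pick A in F].
pose Y := [set F in dense_families r.+1 k U | F \subset Z].
exists (Z :\: [set pickF F | F in Y]); split.
- exact: subset_trans (subsetDl _ _) ZU.
- move=> S SU Sk; rewrite leqNgt; apply/negP => dense.
  (* From a violating [S], exactly one edge too many is extracted. This forms a dense family inside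
     [Z], one of whose members was deleted. *)
  have /card_geqP[fs [fs_uniq fs_size fsH]] := dense.
  (* This makes the truncated subtraction [#|S| - r] exact. *)
  have Sr : (r < #|S|)%N.
    have /card_gt0P[h] := leq_ltn_trans (leq0n _) dense.
    rewrite inE => /andP[/setDP[hZ _] hS].
    have := subsetP ZU h hZ; rewrite inE => /andP[_ /eqP <-].
    exact: subset_leq_card.
  pose F := [set h in fs].
  have FH h : h \in F -> h \in Z :\: [set pickF F | F in Y] /\ h \subset S.
    by rewrite inE => /fsH; rewrite in_set => /andP[].
  have cF : #|F| = (#|S| - r).+1 by rewrite cardsE (card_uniqP fs_uniq).
  have FY : F \in Y.
    rewrite in_set inE; apply/andP; split; last first.
      by apply/subsetP => h /FH[/setDP[]].
    apply/existsP; exists S; rewrite SU Sk /= cF; apply/andP; split.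
      by apply/subsetP => h /FH[_]; rewrite inE.
    by apply/eqP; clear -Sr; lia.
  have pF : pickF F \in F.
    rewrite /pickF; case: pickP => [//|F0].
    by have := eq_card0 F0; rewrite cF.
  by have [/setDP[_ /imsetP]] := FH _ pF; case; exists F.
- have sN : (C.+1.*2 * s ^ r * q <= #|rsubsets r.+1 U|)%N.
    rewrite /rsubsets cards_draws cU.
    rewrite -(@leq_pmul2l A) //.
    apply: leq_trans (bin_ge _); last by rewrite /q in qs *; lia.
    have -> : (s ^ r.+1 = A * C.+1.*2 * q * s ^ r)%N by rewrite expnS.
    by rewrite !mulnA [leqRHS]mulnAC.
  have Q0 : 0 < q%:R :> rat by rewrite ltr0n.
  have hN : (C.+1.*2 * s ^ r)%:R <= #|rsubsets r.+1 U|%:R / q%:R :> rat.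
    by rewrite ler_pdivlMr // -natrM ler_nat.
  have hD : \sum_(F in dense_families r.+1 k U) (q%:R ^+ #|F|)^-1 <=
      (s ^ r)%:R :> rat.
    apply: (le_trans (sum_dense_families r.+1 k L0 q0 cU)).
    have -> : q%:R ^+ r.+1 / q%:R ^+ 2 = q%:R ^+ r / q%:R :> rat.
      by rewrite exprSr expr2 invfM mulrA mulfK // gt_eqF.
    apply: (@le_trans _ _ (q%:R * (q%:R ^+ r / q%:R))).
      rewrite ler_wpM2r ?divr_ge0 ?exprn_ge0 ?ler0n // ler_nat.
      exact: leq_addr.
    rewrite mulrCA mulfV ?gt_eqF // mulr1 -natrX ler_nat.
    by case: (r) => // r'; rewrite leq_exp2r.
  have YH : (#|Z| <= #|Z :\: [set pickF F | F in Y]| + #|Y|)%N.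
    rewrite -(cardsID [set pickF F | F in Y] Z) addnC leq_add2l.
    apply: leq_trans (leq_imset_card pickF (mem Y)).
    exact: subset_leq_card (subsetIr _ _).
  have : (C * s ^ r)%:R + (s ^ r)%:R <= (C.+1.*2 * s ^ r)%:R :> rat.
    by rewrite -natrD ler_nat -mulSnr leq_mul2r -addnn leq_addr orbT.
  rewrite -(ler_nat rat); move: YH; rewrite -(ler_nat rat) natrD.
  move: hN hD cZ; rewrite -/Y; move: (\sum_(_ in _) _) (_ / _) => Sig N.
  move: (#|_|%:R) (#|_|%:R) (#|_|%:R) => y z h.
  move: (_%:R) (_%:R) (_%:R) => a b c; lra.
Qed.

(** * The Frankl–Rödl construction *)

(* The vertices of [D] are sent to distinct copies of [v] other than the first,
   and each other vertex to the first copy of its image. *)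
Lemma exists_FR_map (r : nat) (X V : finType) (pi : X -> V) (P : pattern r V)
    (v : V) (D : {set X}) :
  #|D|.+1 = r -> D \subset fiber pi v ->
  exists psi : X -> {u : V & 'I_(FR_copies r v u)},
    blowup_edges pi P \subset blowup_edges psi (FR v P) /\
    (forall b, b \in fiber pi v -> b \notin D ->
       b |: D \in blowup_edges psi (FR v P)).
Proof.
move=> cD DU.
pose idx a := if a \in D then (index a (enum D)).+1 else 0%N.
have Dv a : a \in D -> pi a = v.
  by move=> /(subsetP DU); rewrite inE => /eqP.
have idx_lt a : (idx a < FR_copies r v (pi a))%N.
  rewrite /idx /FR_copies; case: ifP => [aD|_]; last by case: ifP; rewrite -?cD.
  by rewrite (Dv a aD) eqxx -cD ltnS cardE index_mem mem_enum.
pose psi a := Tagged (fun u => 'I_(FR_copies r v u)) (Ordinal (idx_lt a)).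
have psi_tag a : tag (psi a) = pi a by [].
have psi_idx a : nat_of_ord (tagged (psi a)) = idx a by [].
have psiE q a : tag q = pi a -> nat_of_ord (tagged q) = idx a -> psi a = q.
  case: q => u i /= ua; subst u => ia.
  by rewrite /psi /Tagged; congr existT; apply: ord_inj.
have idx_inj a b : a \in D -> b \in D -> idx a = idx b -> a = b.
  move=> aD bD; rewrite /idx aD bD => /eq_add_S.
  by apply: (index_inj a); rewrite mem_enum.
have psi_inj a b : psi a = psi b -> idx a = idx b.
  by move=> ab; rewrite -!psi_idx ab.
exists psi; split=> [|b bU bD].
  (* The type of [A] under [psi] projects to its type under [pi]; a copy of positive index receives
     at most one vertex, because [idx] is injective on [D]. *)
  apply/subsetP => A AP; have cA := card_blowup_edge AP.
  have /blowup_edgesP[e eP eA] := AP.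
  have [f fA] := rmset_of_set psi cA.
  apply/blowup_edgesP; exists f => //; rewrite inE; apply/orP; left.
  rewrite inE; apply/andP; split.
    rewrite inE; apply/existsP; exists e; rewrite eP; apply/forallP => u /=.
    apply/eqP; rewrite -eA.
    transitivity (\sum_(q | tag q == u) #|A :&: fiber psi q|)%N; last first.
      rewrite -[RHS]sum1_card (partition_big psi (fun q => tag q == u)) /=.
        apply: eq_bigr => q /eqP qu; rewrite -sum1_card; apply: eq_bigl => a.
        rewrite !inE -andbA; congr (_ && _); apply/eqP/andP => [aq|[_ /eqP //]].
        by rewrite -qu -aq !eqxx.
      by move=> a; rewrite !inE => /andP[_ /eqP <-].
    under eq_bigr do rewrite fA.
    transitivity (\sum_(u' | u' == u) \sum_(i < FR_copies r v u')
        #|A :&: fiber psi (Tagged (fun u => 'I_(FR_copies r v u)) i)|)%N.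
      by rewrite big_pred1_eq.
    by rewrite sig_big_dep; apply: eq_big => [[u' i]|[u' i] _] //=; rewrite andbT.
  apply/forallP => q; apply/implyP => /andP[_ q0]; rewrite fA.
  apply/card_le1_eqP => a c; rewrite !inE => /andP[_ /eqP aq] /andP[_ /eqP cq].
  have acD d : psi d = q -> d \in D.
    move=> dq; move: q0; rewrite -dq psi_idx /idx; by case: ifP.
  apply: idx_inj; rewrite ?acD //; apply: psi_inj; by rewrite aq cq.
(* Here [b] goes to the first copy of [v] and [D] fills the others, so [b |: D] has the type of the
   special edge. *)
have cbD : #|b |: D| = r by rewrite cardsU1 bD.
have bDv a : a \in b |: D -> pi a = v.
  by move=> /setU1P[->|/Dv //]; move: bU; rewrite inE => /eqP.
have [f fA] := rmset_of_set psi cbD.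
apply/blowup_edgesP; exists f => //; rewrite inE; apply/orP; right.
rewrite inE; apply/forallP => q; rewrite fA; apply/eqP.
have [qv|qv] := eqVneq (tag q) v; last first.
  apply/eqP; rewrite cards_eq0; apply/eqP/setP => a; rewrite in_set0.
  apply/negP => /setIP[/bDv av]; rewrite inE => /eqP aq.
  by case/eqP: qv; exact: etrans (congr1 tag (esym aq)) av.
have [c cbD' cq] : exists2 c, c \in b |: D & psi c = q.
  case q0 : (nat_of_ord (tagged q)) => [|i].
    exists b; first exact: setU11.
    apply: psiE; first exact: etrans qv (esym (bDv b (setU11 b D))).
    by rewrite q0 /idx (negbTE bD).
  have iD : (i < size (enum D))%N.
    have := ltn_ord (tagged q); rewrite q0 [X in (_ < X)%N]/FR_copies qv eqxx.
    by rewrite -cD ltnS -cardE.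
  have cD' : nth b (enum D) i \in D by rewrite -mem_enum mem_nth.
  exists (nth b (enum D) i); first by rewrite in_setU1 cD' orbT.
  apply: psiE; first exact: etrans qv (esym (Dv _ cD')).
  by rewrite q0 /idx cD' index_uniq ?enum_uniq.
apply/eqP/cards1P; exists c; apply/setP => a; rewrite in_set1.
apply/setIP/eqP => [[abD]|->]; last by split=> //; rewrite inE cq.
rewrite inE => /eqP aq; have := psi_inj a c; rewrite aq cq => /(_ erefl).
move: abD cbD' => /setU1P[->|aD] /setU1P[->|cD'] //; last exact: idx_inj.
  by rewrite /idx cD' (negbTE bD).
by rewrite /idx aD (negbTE bD).
Qed.

Lemma edge_weight_ge0 (R : realType) (r : nat) (V : finType) (w : V -> R)
    (e : rmset r V) : weighting w -> 0 <= edge_weight w e.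
Proof.
move=> [w0 _]; apply: prodr_ge0 => u _.
by rewrite mulr_ge0 ?exprn_ge0 // invr_ge0 ler0n.
Qed.

Lemma lagrangian_ge0 (R : realType) (r : nat) (V : finType) (P : pattern r V)
    (w : V -> R) : maximal_weighting P w -> 0 <= lagrangian R P.
Proof.
by move=> [ww <-]; apply: sumr_ge0 => e _; exact: edge_weight_ge0.
Qed.

(** Otherwise putting all the weight on [v] would give at least [1 / r!]. Hence no edge of a blow-up
    of [P] lies inside the part of [v], and edges added there are new. *)
Lemma no_full_edge (R : realType) (r : nat) (V : finType) (P : pattern r V)
    (v : V) (e : rmset r V) :
  r`!%:R * lagrangian R P < 1 -> e \in P -> e v <> r :> nat.
Proof.
move=> lt1 eP ev.
have V0 : (0 < #|V|)%N by apply/card_gt0P; exists v.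
pose w (u : V) : R := (u == v)%:R.
have w0 u : 0 <= w u by exact: ler0n.
have ww : weighting w.
  by split=> //; rewrite (bigD1 v) //= /w eqxx big1 ?addr0 // => u /negbTE->.
have := (lagrangian_max R P V0).2 w ww; apply/negP; rewrite -ltNge.
have f0 : 0 < r`!%:R :> R by rewrite ltr0n fact_gt0.
rewrite -(ltr_pM2l f0); apply: (lt_le_trans lt1).
rewrite /pattern_weight (bigD1 e) //= mulrDr.
have -> : edge_weight w e = r`!%:R^-1.
  have e0 u : u != v -> e u = 0%N :> nat.
    move=> uv; have := rmset_sum e; rewrite (bigD1 v) //= ev.
    move/eqP; rewrite -[X in _ == X]addn0 eqn_add2l sum_nat_eq0.
    by move=> /forallP/(_ u); rewrite uv => /eqP.
  rewrite /edge_weight (bigD1 v) //= big1 => [|u uv].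
    by rewrite /w eqxx expr1n ev mulr1 mul1r.
  by rewrite (e0 u uv) expr0 fact0 divr1.
rewrite mulfV ?gt_eqF // lerDl mulr_ge0 ?ler0n //; apply: sumr_ge0 => f _.
exact: edge_weight_ge0.
Qed.

Lemma loaded_blowup_le (R : realType) (r n : nat) (X V : finType)
    (pi : X -> V) (P : pattern r V) (v : V) (H : {set {set X}}) (x : X -> R) :
  (0 < r)%N -> (forall e : rmset r V, e \in P -> e v <> r :> nat) ->
  (r.-1 <= #|fiber pi v|)%N -> H \subset rsubsets r (fiber pi v) ->
  (forall S : {set X}, S \subset fiber pi v -> (#|S| <= n + r)%N ->
     (#|[set h in H | h \subset S]| <= #|S| - r.-1)%N) ->
  weighting x -> (#|[set a | x a != 0%R]| <= n)%N ->
  \sum_(A in blowup_edges pi P :|: H) \prod_(a in A) x a <=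
  lagrangian R (FR v P).
Proof.
case: r P => // r P _ nfull rU HU sparse [x0 x1] xn; set U := fiber pi v.
have [D [DU cD top]] := exists_top x rU.
(* Only added edges inside the support of [x] have nonzero weight; together with [D] this leaves few
   enough vertices for [sparse] to apply. *)
pose S := D :|: ([set a | x a != 0] :&: U).
have SU : S \subset U by rewrite subUset DU subsetIr.
have DS : D \subset S by exact: subsetUl.
have cS : (#|S| <= n + r.+1)%N.
  rewrite (leq_trans (leq_card_setU _ _)) // cD addnC leq_add //.
  exact: leq_trans (subset_leq_card (subsetIl _ _)) xn.
have cH h : h \in H -> #|h| = #|D|.+1.
  by move=> /(subsetP HU); rewrite inE cD => /andP[_ /eqP].
(* The added edges are replaced by the star of all edges through the core [D], which weighs at least
   as much and which [psi] sends to the special edge. *)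
pose E2 := [set b |: D | b in U :\: D].
have HE2 : \sum_(h in H) \prod_(a in h) x a <= \sum_(A in E2) \prod_(a in A) x a.
  have -> : \sum_(h in H) \prod_(a in h) x a =
      \sum_(h in H | h \subset S) \prod_(a in h) x a.
    rewrite [LHS](bigID (fun h : {set X} => h \subset S)) /=.
    rewrite [X in _ + X]big1 ?addr0 //.
    move=> h /andP[hH /subsetPn[a ah aS]]; rewrite (bigD1 a) //=.
    have aU : a \in U.
      by have := subsetP HU h hH; rewrite inE => /andP[/subsetP/(_ _ ah)].
    move: aS; rewrite in_setU in_setI aU andbT negb_or => /andP[_].
    by rewrite inE negbK => /eqP ->; rewrite mul0r.
  apply: (@le_trans _ _ (\prod_(d in D) x d * \sum_(b in S :\: D) x b)).
    apply: sparse_weight => // [d b dD /(subsetP SU) bU|S' DS' S'S].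
      exact: top.
    rewrite cardsD (setIidPr DS') cD; apply: sparse.
      exact: subset_trans SU.
    exact: leq_trans (subset_leq_card S'S) cS.
  rewrite /E2 big_imset /=; last first.
    move=> b c /setDP[_ bD] /setDP[_ cD'] /setP/(_ b).
    by rewrite setU11 in_setU1 (negbTE bD) orbF => /esym/eqP.
  apply: (@le_trans _ _ (\prod_(d in D) x d * \sum_(b in U :\: D) x b)).
    rewrite ler_wpM2l ?prodr_ge0 //.
    rewrite [leRHS](big_setID S) /= setIC setIDA (setIidPl SU) lerDl.
    by rewrite sumr_ge0.
  rewrite mulr_sumr; apply: ler_sum => b /setDP[_ bD].
  by rewrite big_setU1 //= mulrC.
have sumU (F : {set {set X}}) : F \subset rsubsets r.+1 U ->
    \sum_(A in blowup_edges pi P :|: F) \prod_(a in A) x a =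
    \sum_(A in blowup_edges pi P) \prod_(a in A) x a +
    \sum_(A in F) \prod_(a in A) x a.
  move=> FU; rewrite -bigU; first by apply: eq_bigl => A; rewrite in_setU.
  apply/pred0P => A /=; apply/negP => /andP[/blowup_edgesP[e eP eA]].
  move=> /(subsetP FU); rewrite inE => /andP[AU /eqP cA].
  by apply: (nfull e eP); rewrite -eA (setIidPl AU).
have E2U : E2 \subset rsubsets r.+1 U.
  apply/subsetP => _ /imsetP[b /setDP[bU bD] ->].
  by rewrite inE subUset sub1set bU DU cardsU1 bD cD add1n eqxx.
have [psi [psiP psiD]] := exists_FR_map P (congr1 succn cD) DU.
pose y q := \sum_(a in fiber psi q) x a.
have y_weighting : weighting y.
  split=> [q|]; first by rewrite /y sumr_ge0.
  rewrite -x1 [RHS](partition_big psi predT) //=; apply: eq_bigr => q _.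
  by apply: eq_bigl => a; rewrite inE.
have V'0 : (0 < #|{: {u : V & 'I_(FR_copies r.+1 v u)}}|)%N.
  have pos : (0 < FR_copies r.+1 v v)%N by rewrite /FR_copies eqxx.
  apply/card_gt0P.
  by exists (Tagged (fun u => 'I_(FR_copies r.+1 v u)) (Ordinal pos)).
apply: le_trans ((lagrangian_max R (FR v P) V'0).2 y y_weighting).
apply: le_trans (sum_blowup_edges_le psi (FR v P) x0).
rewrite (sumU _ HU); apply: (le_trans (lerD (lexx _) HE2)).
rewrite -(sumU _ E2U).
rewrite [leRHS](big_setID (blowup_edges pi P :|: E2)) /= (setIidPr _).
  by rewrite lerDl sumr_ge0 // => A _; exact: prodr_ge0.
rewrite subUset psiP; apply/subsetP => _ /imsetP[b /setDP[bU bD] ->].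
exact: psiD.
Qed.

Lemma card_fiber_tag (V : finType) (k : V -> nat) (u : V) :
  #|fiber (fun a : {u : V & 'I_(k u)} => tag a) u| = k u.
Proof.
transitivity (\sum_(u' | u' == u) \sum_(i < k u') 1)%N.
  rewrite sig_big_dep -sum1_card; apply: eq_bigl => a.
  by rewrite inE andbT.
by rewrite big_pred1_eq sum1_card card_ord.
Qed.

Lemma exists_dense_light_graph (R : realType) (r n : nat) (V : finType)
    (P : pattern r V) (v : V) (w : V -> R) :
  (0 < r)%N -> maximal_weighting P w -> 0 < w v ->
  (forall e : rmset r V, e \in P -> e v <> r :> nat) ->
  exists (X : finType) (E : {set {set X}}), [/\ (0 < #|X|)%N,
    forall A, A \in E -> #|A| = r,
    lagrangian R P * #|X|%:R ^+ r < #|E|%:R &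
    forall x : X -> R, weighting x -> (#|[set a | x a != 0%R]| <= n)%N ->
      \sum_(A in E) \prod_(a in A) x a <= lagrangian R (FR v P)].
Proof.
case: r P => // r P r0 wP wv0 nfull; have l0 := lagrangian_ge0 wP.
have [[w0 w1] wmax] := wP.
have w01 u : 0 <= w u <= 1.
  by rewrite w0 -w1 (bigD1 u) //= lerDl sumr_ge0.
(* With [r] now the uniformity minus one, rounding the parts costs at most [B * t ^ r] edges. The
   constant [C] is chosen so that [C * s ^ r] added edges, with [s = w v * t], outweigh this
   loss. *)
pose B : R := #|P|%:R * (r.+1%:R * r.+2%:R).
have B0 : 0 <= B by rewrite !mulr_ge0.
have wvr0 : 0 < w v ^+ r by rewrite exprn_gt0.
pose C := (Num.truncn (B / w v ^+ r)).+1.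
have BC : B < C%:R * w v ^+ r by rewrite -ltr_pdivrMr // truncnS_gt.
have [s [s0 rs sparse]] := @exists_sparse_family r.+1 (n + r.+1) C r0.
(* This scale makes the part of [v] have exactly [s] vertices; the other parts are rounded down, so
   that [#|X| <= t]. *)
pose t : R := s%:R / w v.
have t0 : 0 < t by rewrite divr_gt0 // ltr0n.
pose k u := Num.truncn (w u * t).
have wt0 u : 0 <= w u * t by rewrite mulr_ge0 // ltW.
have kv : k v = s by rewrite /k /t mulrCA mulfV ?gt_eqF // mulr1 natrK.
pose X : finType := {u : V & 'I_(k u)}.
pose pi (a : X) := tag a.
have fE u : #|fiber pi u| = k u by exact: card_fiber_tag.
have kle u : (k u)%:R <= w u * t by rewrite truncn_le.
have kge u : w u * t - 1 <= (k u)%:R.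
  by rewrite lerBlDr natr1 ltW // truncnS_gt.
have [|H [HU Hsparse Hcard]] := sparse X (fiber pi v); first by rewrite fE kv.
have Xt : #|X|%:R <= t.
  rewrite -cardsT -(card_fibers pi) natr_sum.
  rewrite -[leRHS]mul1r -[X in _ <= X * _]w1 mulr_suml; apply: ler_sum => u _.
  by rewrite setTI fE.
exists X, (blowup_edges pi P :|: H); split.
- by rewrite -cardsT -(card_fibers pi) (bigD1 v) //= setTI fE kv addn_gt0 s0.
- move=> A /setUP[/card_blowup_edge //|/(subsetP HU)].
  by rewrite inE => /andP[_ /eqP].
- apply: (@le_lt_trans _ _ (lagrangian R P * t ^+ r.+1)).
    by rewrite ler_wpM2l // lerXn2r ?nnegrE ?ler0n // ltW.
  have -> : #|blowup_edges pi P :|: H|%:R =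
      #|blowup_edges pi P|%:R + #|H|%:R :> R.
    rewrite -natrD cardsU (_ : _ :&: H = set0) ?cards0 ?subn0 //.
    apply/setP => A; rewrite in_set0; apply/negP.
    move=> /setIP[/blowup_edgesP[e eP eA] /(subsetP HU)].
    rewrite inE => /andP[AU /eqP cA].
    by apply: (nfull e eP); rewrite -eA (setIidPl AU).
  have fw u : w u * t - 1 <= #|fiber pi u|%:R <= w u * t.
    by rewrite fE kge kle.
  have := blowup_edges_ge P t0 w01 fw; rewrite wmax => blow.
  have tB : t ^+ r.+1 *
      (lagrangian R P - #|P|%:R * (r.+1%:R * (r.+2%:R / t))) =
      lagrangian R P * t ^+ r.+1 - B * t ^+ r.
    by rewrite /B exprS; field; rewrite gt_eqF.
  have Ht : C%:R * (w v ^+ r * t ^+ r) <= #|H|%:R :> R.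
    rewrite -exprMn /t mulrCA mulfV ?gt_eqF // mulr1 -natrX -natrM ler_nat.
    exact: Hcard.
  have BCt : B * t ^+ r < C%:R * w v ^+ r * t ^+ r.
    by rewrite ltr_pM2r ?exprn_gt0.
  move: blow Ht BCt; rewrite tB mulrA.
  move: (lagrangian R P * _) (C%:R * _ * _) (B * _) (#|_|%:R) (#|_|%:R).
  by move=> p q x y z; lra.
move=> x xw xn; apply: (@loaded_blowup_le _ _ n) => //.
by rewrite fE kv ltnW.
Qed.

(** * Large blow-ups and the contradiction *)

Lemma exists_binomial_gt (R : realType) (r : nat) (lam delta : R) :
  0 <= lam -> 0 < delta ->
  exists n, (r <= n)%N /\ lam * n%:R ^+ r < (r`!%:R * lam + delta) * 'C(n, r)%:R.
Proof.
move=> l0 d0.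
have f0 : 0 < r`!%:R :> R by rewrite ltr0n fact_gt0.
pose a := r`!%:R * lam + delta.
have a0 : 0 < a by rewrite ltr_wpDl ?mulr_ge0 // ltW.
(* For [n > c] the error of [bin_sub_le] at [x = 1] and [t = k = n], multiplied by [a], is below
   [delta / r!], the gain due to [delta]. *)
pose c := r%:R * r.+1%:R * a * r`!%:R / delta.
exists (Num.truncn c + r).+1; split; first by rewrite ltnW // ltnS leq_addl.
set n := (_ + r).+1; have n0 : 0 < n%:R :> R by rewrite ltr0n.
have nc : c < n%:R.
  by apply: lt_le_trans (truncnS_gt c) _; rewrite ler_nat ltnS leq_addr.
have one01 : 0 <= (1 : R) <= 1 by rewrite ler01 lexx.
have nn : 1 * n%:R - 1 <= (n%:R : R) <= 1 * n%:R.
  by rewrite mul1r lexx andbT lerBlDr lerDl ler01.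
have [_] := bin_sub_le n0 one01 nn (leqnn r).
rewrite expr1n mul1r => bin.
have nr0 : 0 < n%:R ^+ r :> R by rewrite exprn_gt0.
rewrite -(ltr_pdivlMr _ _ nr0) -mulrA.
have small : r%:R * (r.+1%:R / n%:R) * a < delta / r`!%:R.
  rewrite ltr_pdivlMr // (_ : _ * r`!%:R = c * delta / n%:R); last first.
    by rewrite /c; field; rewrite !gt_eqF.
  by rewrite ltr_pdivrMr // mulrC ltr_pM2l.
apply: (@lt_le_trans _ _ (a * (r`!%:R^-1 - r%:R * (r.+1%:R / n%:R)))).
  have -> : a * (r`!%:R^-1 - r%:R * (r.+1%:R / n%:R)) =
      lam + (delta / r`!%:R - r%:R * (r.+1%:R / n%:R) * a).
    by rewrite /a; field; rewrite !gt_eqF.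
  by rewrite ltrDl subr_gt0.
by rewrite ler_pM2l // lerBlDr addrC -lerBlDr.
Qed.

Lemma card_fiber_fst (X : finType) (b : nat) (a : X) :
  #|fiber (fun y : X * 'I_b => y.1) a| = b.
Proof.
transitivity (\sum_(a' | a' == a) \sum_(i < b) 1)%N.
  rewrite pair_big_dep -sum1_card; apply: eq_bigl => y.
  by rewrite inE andbT.
by rewrite big_pred1_eq sum1_card card_ord.
Qed.

Lemma card_transversals (r : nat) (X : finType) (b : nat) (E : {set {set X}}) :
  (forall A, A \in E -> #|A| = r) ->
  #|transversals (fun y : X * 'I_b => y.1) E| = (#|E| * b ^ r)%N.
Proof.
move=> Er; apply/eqP; rewrite -(eqr_nat rat) natrM natrX; apply/eqP.
transitivity (\sum_(h in transversals (fun y : X * 'I_b => y.1) E)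
    \prod_(y in h) (1 : rat)).
  by rewrite -sum1_card natr_sum; apply: eq_bigr => h _; rewrite big1.
rewrite sum_transversals mulr_natl -sumr_const; apply: eq_bigr => A AE.
rewrite -(Er A AE) -prodr_const; apply: eq_bigr => a _.
by rewrite sumr_const card_fiber_fst.
Qed.

(** Each vertex is weighted by the share of [W] above it. At most [n] weights are nonzero, and
    [n ^ r] times the weight of [E] counts the transversals inside [W]. *)
Lemma card_subset_transversals_le (R : realType) (r n : nat) (lam : R)
    (X Y : finType) (pi : Y -> X) (E : {set {set X}}) (W : {set Y})
    (F : {set {set Y}}) :
  (forall A, A \in E -> #|A| = r) -> (0 < n)%N -> #|W| = n ->
  (forall x : X -> R, weighting x -> (#|[set a | x a != 0%R]| <= n)%N ->
      \sum_(A in E) \prod_(a in A) x a <= lam) ->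
  F \subset transversals pi E -> (forall h, h \in F -> h \subset W) ->
  #|F|%:R <= lam * n%:R ^+ r.
Proof.
move=> Er n0 cW light FE FW.
have n0' : 0 < n%:R :> R by rewrite ltr0n.
pose x a : R := #|W :&: fiber pi a|%:R / n%:R.
have x0 a : 0 <= x a by rewrite divr_ge0 ?ler0n.
have xw : weighting x.
  split=> //; rewrite -mulr_suml -natr_sum card_fibers cW mulfV // gt_eqF //.
have xn : (#|[set a | x a != 0%R]| <= n)%N.
  rewrite -cW; apply: leq_trans (leq_imset_card pi (mem W)).
  apply: subset_leq_card; apply/subsetP => a; rewrite inE.
  rewrite mulf_eq0 negb_or pnatr_eq0 cards_eq0 => /andP[/set0Pn[y]].
  rewrite 2!inE => /andP[yW /eqP <-] _; exact: imset_f.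
rewrite -ler_pdivrMr ?exprn_gt0 //; apply: le_trans (light x xw xn).
rewrite ler_pdivrMr ?exprn_gt0 // mulr_suml.
have -> : \sum_(A in E) (\prod_(a in A) x a) * n%:R ^+ r =
    \sum_(h in transversals pi E) \prod_(y in h) (y \in W)%:R.
  rewrite sum_transversals; apply: eq_bigr => A AE.
  rewrite -(Er A AE) -prodr_const -big_split /=; apply: eq_bigr => a _.
  rewrite /x divfK ?gt_eqF // -natr_sum -sum1_card; congr (_%:R).
  rewrite [RHS]big_mkcond [LHS]big_mkcond; apply: eq_bigr => y _.
  by rewrite in_setI; case: (y \in W); case: (y \in _).
rewrite [leRHS](big_setID F) /= (setIidPr FE) -[leLHS]addr0 lerD //; last first.
  by apply: sumr_ge0 => h _; apply: prodr_ge0 => y _; exact: ler0n.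
rewrite -sum1_card natr_sum; apply: ler_sum => h hF.
by rewrite big1 // => y /(subsetP (FW h hF)) ->.
Qed.

Lemma ffact_leq (m r : nat) : (m ^_ r <= m ^ r)%N.
Proof.
rewrite ffact_prod -[X in (_ <= _ ^ X)%N]card_ord -prod_nat_const.
by apply: leq_prod => i _; exact: leq_subr.
Qed.

Theorem theorem3p1 (R : realType) (r : nat) (r_gt0 : (0 < r)%N)
    (V : finType) (P : pattern r V) (v : V)
    (v_pos : exists2 w : V -> R, maximal_weighting P w & 0 < w v)
    (FR_lagrangian : lagrangian R (FR v P) = lagrangian R P)
    (lagrangian_lt1 : r`!%:R * lagrangian R P < 1) :
  ~ jump r (r`!%:R * lagrangian R P).
Proof.
have [w wmax wv] := v_pos; move=> [delta d0 jumpP].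
have [n [rn nbig]] := exists_binomial_gt r (lagrangian_ge0 wmax) d0.
have n0 : (0 < n)%N by exact: leq_trans rn.
have nfull (e : rmset r V) (eP : e \in P) :=
  @no_full_edge R r V P v e lagrangian_lt1 eP.
have [X [E [X0 Er Ebig light]]] := exists_dense_light_graph n r_gt0 wmax wv nfull.
have f0 : 0 < r`!%:R :> R by rewrite ltr0n fact_gt0.
have Xr0 : 0 < #|X|%:R ^+ r :> R by rewrite exprn_gt0 // ltr0n.
(* The first term is the limit density of the blow-ups of [E]; [Ebig] places it above
   [r! lambda(P)]. *)
pose eps : R := r`!%:R * #|E|%:R / #|X|%:R ^+ r - r`!%:R * lagrangian R P.
have eps0 : 0 < eps.
  by rewrite subr_gt0 ltr_pdivlMr // -mulrA ltr_pM2l.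
have [N HN] := jumpP eps n eps0 rn.
(* Parts of size at least [N] make the blow-up large enough, and size at least [r] makes the
   denominator of its density nonzero. *)
pose b := maxn N r.
have b0 : (0 < b)%N by rewrite leq_max r_gt0 orbT.
pose G := RGraph (transversals_rsubsets (fun y : X * 'I_b => y.1) Er).
have bX : (b <= #|{: X * 'I_b}|)%N by rewrite card_prod card_ord leq_pmull.
have rsub (S : {set X * 'I_b}) : #|rsubsets r S| = 'C(#|S|, r).
  by rewrite /rsubsets cards_draws.
have [|| K [KG Kn Kd]] := HN _ G.
- by rewrite /rgraph_order cardsT; apply: leq_trans bX; exact: leq_maxl.
(* Every blow-up has at least the limit density, since a falling factorial is at most the
   corresponding power. *)
- rewrite /density rsub cardsT (card_transversals _ Er) /eps addrC subrK.
  have C0 : 0 < 'C(#|{: X * 'I_b}|, r)%:R :> R.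
    by rewrite ltr0n bin_gt0; apply: leq_trans bX; exact: leq_maxr.
  rewrite ler_pdivlMr // mulrAC ler_pdivrMr // -natrX -!natrM ler_nat.
  rewrite mulnAC (mulnC _ #|E|) -mulnA leq_mul2l mulnC bin_ffact.
  by rewrite -expnMn mulnC -[X in (_ * X)%N]card_ord -card_prod ffact_leq orbT.
have K0 : 0 < #|rsubsets r (vertices K)|%:R :> R.
  by rewrite rsub [X in 'C(X, _)]Kn ltr0n bin_gt0.
(* The subgraph [K] would have at least [(r! lambda + delta) * 'C(n, r)] edges, but lightness allows
   at most [lambda * n ^ r], contrary to the choice of [n]. *)
move: Kd; rewrite /density ler_pdivlMr // rsub [X in 'C(X, _)]Kn.
have [KV KE] := andP KG.
have KW h : h \in edges K -> h \subset vertices K.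
  by move=> /(subsetP (edges_rsubsets K)); rewrite inE => /andP[].
rewrite FR_lagrangian in light.
have up := card_subset_transversals_le Er n0 Kn light KE KW.
by move=> low; have := lt_le_trans nbig low; rewrite ltNge up.
Qed.
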